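(* Let $n\ge 3$ and let $J\subset\mathbb{Z}_n$ be a primitive subset in standard form. Then the graph $GI(n;J)$ is vertex-transitive if and only if either $J\cup -J$ is a (multiplicative) subgroup of $\mathbb{Z}_n^{*}$, or $n=10$ and $J=\{1,2\}$.
   Context: For integers $n\ge 3$, $t\ge 1$ and a sequence (or multiset) $J=\{j_0,\dots,j_{t-1}\}$ of integers with $0<j_k<n$ and $j_k\neq n/2$ (viewed mod $n$), the $GI$-graph $GI(n;J)=GI(n;j_0,\dots,j_{t-1})$ is the graph with vertex set $\mathbb{Z}_t\times\mathbb{Z}_n$ and two types of edges: an edge joining $(s,v)$ to $(s',v)$ for all distinct $s,s'\in\mathbb{Z}_t$ and all $v\in\mathbb{Z}_n$; and edges joining $(s,v)$ to $(s,v+j_s)$ and $(s,v-j_s)$ for all $s\in\mathbb{Z}_t$, $v\in\mathbb{Z}_n$. $J$ is in standard form if $0<j_k<n/2$ for all $k$ (and $j_0\le\dots\le j_{t-1}$). A subset $J=\{j_0,\dots,j_{t-1}\}$ of $\mathbb{Z}_n$ is primitive if $1\in J$ and $j_i\neq\pm j_k$ in $\mathbb{Z}_n$ whenever $i\neq k$. $\mathbb{Z}_n^{*}$ is the group of units mod $n$. *)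

(* Defs.v *)
From mathcomp Require Import all_boot all_order all_algebra all_fingroup.

Set Implicit Arguments.
Unset Strict Implicit.
Unset Printing Implicit Defensive.

Import GRing.Theory.
Local Open Scope ring_scope.

(* A graph on a finite vertex type is given by its adjacency relation. *)
Definition graph_aut (V : finType) (e : rel V) : {set {perm V}} :=
  [set f : {perm V} | [forall x, forall y, e (f x) (f y) == e x y]].

Lemma graph_aut_group_set (V : finType) (e : rel V) : group_set (graph_aut e).
Proof.
apply/group_setP; split=> [|f g].
  by rewrite inE; apply/forallP=> x; apply/forallP=> y; rewrite !perm1.
rewrite !inE => /forallP ef /forallP eg.
apply/forallP=> x; apply/forallP=> y; rewrite !permM.
by rewrite (eqP (forallP (eg _) _)) (eqP (forallP (ef _) _)).
Qed.

Canonical graph_aut_group (V : finType) (e : rel V) :=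
  Group (graph_aut_group_set e).

Definition vertex_transitive (V : finType) (e : rel V) : Prop :=
  [transitive graph_aut e, on [set: V] | 'P].

(* The first component only labels the entries of J, so it ranges over 'I_t:
   'Z_t would have two elements for t = 1.  The second one ranges over 'Z_n,
   which has n elements only when 1 < n. *)
Definition GI_vertex (n t : nat) : finType := ('I_t * 'Z_n)%type.

Definition GI (n t : nat) (J : t.-tuple 'Z_n) : rel (GI_vertex n t) :=
  fun x y =>
    ((x.1 != y.1) && (x.2 == y.2)) ||
    ((x.1 == y.1) &&
      ((y.2 == x.2 + tnth J x.1) || (y.2 == x.2 - tnth J x.1))).

Lemma GI_sym (n t : nat) (J : t.-tuple 'Z_n) : symmetric (GI J).
Proof.
move=> [s v] [s' v']; rewrite /GI /= eq_sym [v' == v]eq_sym.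
case: eqVneq => //= ->; rewrite orbC.
by rewrite [v' == v - _]eq_sym subr_eq [v == v' - _]eq_sym subr_eq
  [v' == v + _]eq_sym.
Qed.

Lemma GI_irrefl (n t : nat) (J : t.-tuple 'Z_n) :
  (forall k, tnth J k != 0) -> irreflexive (GI J).
Proof.
move=> J0 [s v]; rewrite /GI /= !eqxx /=.
have Jv : (v == v + tnth J s) = false.
  by rewrite -subr_eq0 opprD addNKr oppr_eq0 (negbTE (J0 s)).
by rewrite Jv eq_sym subr_eq Jv.
Qed.

(* Inequalities are between the representatives in {0, ..., n-1}. *)
Definition standard_form (n t : nat) (J : t.-tuple 'Z_n) : Prop :=
  (forall k : 'I_t,
     (0 < (tnth J k : nat))%N /\ (2 * (tnth J k : nat) < n)%N) /\
  (forall i k : 'I_t, (i <= k)%N -> ((tnth J i : nat) <= (tnth J k : nat))%N).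

Definition primitive (n t : nat) (J : t.-tuple 'Z_n) : Prop :=
  1 \in J /\
  (forall i k : 'I_t, i != k ->
     tnth J i != tnth J k /\ tnth J i != - tnth J k).

Definition entries (n t : nat) (J : t.-tuple 'Z_n) : {set 'Z_n} :=
  [set j in J].

Definition mul_subgroup (n : nat) (A : {set 'Z_n}) : Prop :=
  exists H : {group {unit 'Z_n}}, A = [set FinRing.uval u | u in H].

(* Main.v *)
Require Import Defs.
From mathcomp Require Import all_boot all_order all_algebra all_fingroup.
From mathcomp Require Import zify ring.

(** The argument turns on whether automorphisms respect the spokes, the edges
that join different layers.

Suppose that every automorphism maps spokes to spokes, that the layer s0 has
step 1, and that f is an automorphism taking (s0, 0) to (s, 0).  The layer s0 is
one cycle through all of Z_n, so f is determined on it by its value at (s0, 1):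
it is (s0, v) |-> (s, c v) with c = j_s or c = - j_s (unit_layer).  Injectivity
makes c a unit, and since spokes go to spokes the second coordinate is
multiplied by c in every layer; hence c maps J u -J into itself
(layer_map_closed).  Vertex-transitivity supplies such an f for every s, so
J u -J is a set of units closed under products, which is a subgroup because
Z_n is finite (transitive_spokes_subgroup).  Conversely, multiplication by an
element of a subgroup J u -J permutes the layers, and together with the
translations this acts transitively (subgroup_transitive).

It remains to see when spokes are preserved.  With one layer there are none.
With at least three layers every spoke lies in a triangle, while an edge inside
layer s does so only if 3 j_s = 0; this can hold for at most one layer, and
vertex-transitivity then excludes it altogether, so spokes are the edges in
triangles (automorphism_preserves_spokes).

With two layers, steps 1 and k, the graph is a generalized Petersen graph and is
cubic.  The number of closed nonbacktracking walks of length 8 through a 2-path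
is invariant under automorphisms.  It depends only on whether the 2-path
contains a spoke and, if not, on its layer.  If some automorphism maps a spoke to
a layer edge, then vertex-transitivity makes the three numbers equal
(spokes_or_counts).  Each of them is a sum of conditions p + q k = 0 in Z_n, read
off from the displacement of a walk as a word in the steps (closed_walks8_at).
The 8-cycles that follow 1, k, -1, -k alternately with spokes exist for every k
and contribute only to 2-paths with a spoke, so equality forces coincidences
among n and k.  For n > 26 these contradict each other, and below that bound
inspection leaves k^2 = 1, k^2 = -1 or (n, k) = (10, 2)
(dvd_count_square).  In the first two cases {1, -1, k, -k} is a subgroup; the
last one is the dodecahedron, whose automorphism exchanging the ends of a spoke
is given by a table. *)

Set Implicit Arguments.
Unset Strict Implicit.
Unset Printing Implicit Defensive.

Import GRing.Theory.

(** * Spokes and the symmetrized step set *)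

Definition spoke (n t : nat) : rel (GI_vertex n t) :=
  fun x y => (x.1 != y.1) && (x.2 == y.2).

Definition preserves_spokes (n t : nat) (f : GI_vertex n t -> GI_vertex n t) :=
  forall x y, spoke (f x) (f y) = spoke x y.

Definition closed_entries (n t : nat) (J : t.-tuple 'Z_n) : {set 'Z_n} :=
  entries J :|: [set (- j)%R | j in entries J].

(** * Automorphisms and transitivity *)

Section Automorphisms.

Variables (V : finType) (e : rel V).

Lemma graph_autE (f : {perm V}) x y :
  f \in graph_aut e -> e (f x) (f y) = e x y.
Proof. by rewrite inE => /forallP/(_ x)/forallP/(_ y)/eqP. Qed.

Lemma vertex_transitiveE x y :
  vertex_transitive e -> exists2 f : {perm V}, f \in graph_aut e & f x = y.
Proof.
move=> /atransP2/(_ x y); rewrite !inE => /(_ isT isT) [f Af ->].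
by exists f.
Qed.

Lemma vertex_transitive_from x0 :
  (forall y, exists2 f : {perm V}, f \in graph_aut e & f x0 = y) ->
  vertex_transitive e.
Proof.
move=> tr; apply/imsetP; exists x0; rewrite ?inE //.
by apply/setP=> y; rewrite inE; symmetry; apply/orbitP; exact: tr.
Qed.

End Automorphisms.

(** * Arithmetic in Z_n *)

Section Units.

Local Open Scope ring_scope.

(** Inverses come for free in a finite monoid of units. *)
Lemma mul_subgroupP (n : nat) (A : {set 'Z_n}) :
  1 \in A -> {in A, forall x, x \is a GRing.unit} ->
  {in A &, forall x y, x * y \in A} -> mul_subgroup A.
Proof.
move=> A1 Au AM.
pose H := [set u : {unit 'Z_n} | FinRing.uval u \in A].
have gH : group_set H.
  apply/group_setP; split=> [|u v]; rewrite !inE //= => uA vA.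
  exact: AM.
exists (Group gH); apply/setP=> x; apply/idP/imsetP=> [xA|[u]]; last first.
  by rewrite inE => uA ->.
by exists (FinRing.unit 'Z_n (Au x xA)); rewrite ?inE.
Qed.

Lemma inj_mul_unit (n : nat) (c : 'Z_n) :
  injective ( *%R c) -> c \is a GRing.unit.
Proof.
move=> inj; have [g cg gc] := injF_bij inj.
by apply/unitrPr; exists (g 1); rewrite gc.
Qed.

(** The nonzero solutions of 3 z = 0 in Z_n are n/3 and 2n/3. *)
Lemma three_torsion (n : nat) (x y : 'Z_n) :
  x *+ 3 = 0 -> y *+ 3 = 0 -> x != 0 -> y != 0 -> x = y \/ x = - y.
Proof.
have third (z : 'Z_n) : z *+ 3 = 0 -> z != 0 ->
    (3 * z = (Zp_trunc n).+2 \/ 3 * z = 2 * (Zp_trunc n).+2)%N.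
  move=> /(congr1 val); rewrite Zp_mulrn /= -val_eqE /= => z3 z0.
  have zn := ltn_ord z; rewrite mulnC.
  have /dvdnP[q zq] : ((Zp_trunc n).+2 %| z * 3)%N by rewrite /dvdn z3.
  move: z0 zq; case: q => [|[|[|q]]] => z0 zq; nia.
move=> x3 y3 /(third x x3) xn /(third y y3) yn.
case: (eqVneq x y) => [->|xy]; [by left|right; apply/val_inj => /=].
move: xy xn yn (ltn_ord x) (ltn_ord y); rewrite -val_eqE /= => *.
by rewrite modn_small; lia.
Qed.

End Units.

(** * Subgroups and automorphisms preserving spokes *)

Lemma exists_notin (T : finType) (s : seq T) :
  size s < #|T| -> exists r, r \notin s.
Proof.
move=> lt; apply/existsP; apply: contraLR lt; rewrite negb_exists -leqNgt.
move=> /forallP all_s; apply: leq_trans (card_size s).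
by apply/subset_leq_card/subsetP => i _; apply: negbNE.
Qed.

Section GIgraph.

Local Open Scope ring_scope.

Variables (n t : nat) (J : t.-tuple 'Z_n).
Hypothesis J2 : forall k, tnth J k + tnth J k != 0.
Hypothesis Jinj : forall i k, i != k ->
  tnth J i != tnth J k /\ tnth J i != - tnth J k.

Implicit Types (f : {perm GI_vertex n t}) (s : 'I_t) (v w : 'Z_n).

Lemma tnth_neq0 s : tnth J s != 0.
Proof. by apply: contraNneq (J2 s) => ->; rewrite addr0. Qed.

Lemma closed_entriesP (x : 'Z_n) :
  reflect (exists k, x = tnth J k \/ x = - tnth J k) (x \in closed_entries J).
Proof.
apply: (iffP setUP) => [[|/imsetP[j]]|[k [->|->]]].
- by rewrite inE => /tnthP[k ->]; exists k; left.
- by rewrite inE => /tnthP[k ->] ->; exists k; right.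
- by left; rewrite inE mem_tnth.
by right; apply/imsetP; exists (tnth J k); rewrite ?inE ?mem_tnth.
Qed.

Lemma closed_entriesN x : (- x \in closed_entries J) = (x \in closed_entries J).
Proof.
suff imp y : y \in closed_entries J -> - y \in closed_entries J.
  by apply/idP/idP => /imp //; rewrite opprK.
move=> /closed_entriesP[k [] ->]; apply/closed_entriesP; exists k.
  by right.
by left; rewrite opprK.
Qed.

Lemma spoke_GI x y : spoke x y -> GI J x y.
Proof. by rewrite /GI /spoke => ->. Qed.

Lemma layer_edge x y : GI J x y -> ~~ spoke x y ->
  y.1 = x.1 /\ (y.2 = x.2 + tnth J x.1 \/ y.2 = x.2 - tnth J x.1).
Proof.
rewrite /GI /spoke; case: eqP => /= [->|_]; last by rewrite orbF => ->.
by move=> /orP[] /eqP ->; split=> //; [left|right].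
Qed.

Lemma layer_edgeP s v w : GI J (s, v) (s, w) =
  (w == v + tnth J s) || (w == v - tnth J s).
Proof. by rewrite /GI /= eqxx. Qed.

Lemma spoke_irr s v w : spoke (s, v) (s, w) = false.
Proof. by rewrite /spoke eqxx. Qed.

(** Consecutive vertices (s0, v), (s0, v + 1) have images that are joined by a
layer edge, so all images lie in layer s and consecutive ones differ by c or -c;
the sign never changes because f does not fold v + 2 onto v. *)
Lemma unit_layer f s0 s : f \in graph_aut (GI J) -> preserves_spokes f ->
  tnth J s0 = 1 -> f (s0, 0) = (s, 0) ->
  exists2 c : 'Z_n, c = tnth J s \/ c = - tnth J s &
    forall v, f (s0, v) = (s, c * v).
Proof.
move=> Af Sf j1 f0.
have step v : (f (s0, v + 1)).1 = (f (s0, v)).1 /\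
   ((f (s0, v + 1)).2 = (f (s0, v)).2 + tnth J (f (s0, v)).1 \/
    (f (s0, v + 1)).2 = (f (s0, v)).2 - tnth J (f (s0, v)).1).
  apply: layer_edge; last by rewrite Sf spoke_irr.
  by rewrite (graph_autE _ _ Af) layer_edgeP j1 eqxx.
have [c cJ f1] : exists2 c : 'Z_n, c = tnth J s \/ c = - tnth J s &
    f (s0, 1) = (s, c).
  have [] := step 0; rewrite add0r f0 /= => e1 e2.
  exists (f (s0, 1)).2; last by rewrite -e1 -surjective_pairing.
  by rewrite !add0r in e2.
exists c => // v; rewrite -[v]natr_Zp.
suff: f (s0, (v : nat)%:R) = (s, c * (v : nat)%:R) /\
  f (s0, (v : nat).+1%:R) = (s, c * (v : nat).+1%:R) by case.
elim: (v : nat) => [|m [IH1 IH2]]; first by rewrite mulr0 mulr1.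
split=> //; have := step m.+1%:R; rewrite natr1 IH2 /=.
case E: (f (s0, m.+2%:R)) => [r w] /= [e ew].
rewrite e in ew *; congr pair.
have {}ew : w = c * m.+1%:R + c \/ w = c * m.+1%:R - c.
  by case: cJ ew => ->; rewrite ?opprK; case; auto.
case: ew => ew; first by rewrite ew -[m.+2]addn1 natrD mulrDr mulr1.
have ec : c * m.+1%:R - c = c * m%:R by rewrite -[m.+1]addn1 natrD mulrDr mulr1 addrK.
(* a change of sign would give f the same value at m and m + 2 *)
have eq2 : f (s0, m.+2%:R) = f (s0, m%:R) by rewrite E e ew ec IH1.
have [] := perm_inj eq2 => /eqP.
rewrite -subr_eq0 -addn2 natrD addrAC subrr add0r.
by have := J2 s0; rewrite j1 -natrD => /negbTE ->.
Qed.

(** Each spoke has constant second coordinate, so f multiplies this coordinate by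
c in all layers; an edge of step x in a layer then becomes an edge of step c x. *)
Lemma layer_map_closed f s0 s c : f \in graph_aut (GI J) -> preserves_spokes f ->
  (forall v, f (s0, v) = (s, c * v)) ->
  {in closed_entries J, forall x, c * x \in closed_entries J}.
Proof.
move=> Af Sf fc.
have f2 k v : (f (k, v)).2 = c * v.
  have [->|ne] := eqVneq k s0; first by rewrite fc.
  have /andP[_ /eqP ->] : spoke (f (k, v)) (f (s0, v)).
    by rewrite Sf /spoke /= ne eqxx.
  by rewrite fc.
suff cJ k : c * tnth J k \in closed_entries J.
  by move=> x /closed_entriesP[k [] ->]; rewrite ?mulrN ?closed_entriesN.
have [] := @layer_edge (f (k, 0)) (f (k, tnth J k)).
- by rewrite (graph_autE _ _ Af) layer_edgeP add0r eqxx.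
- by rewrite Sf spoke_irr.
move=> _; rewrite !f2 mulr0 add0r sub0r => cj.
by apply/closed_entriesP; exists (f (k, 0)).1.
Qed.

Lemma transitive_spokes_subgroup s0 : tnth J s0 = 1 ->
  vertex_transitive (GI J) ->
  (forall f, f \in graph_aut (GI J) -> preserves_spokes f) ->
  mul_subgroup (closed_entries J).
Proof.
move=> j1 tr spk.
have mapP k : exists2 c, c = tnth J k \/ c = - tnth J k &
   exists2 f, f \in graph_aut (GI J) & forall v, f (s0, v) = (k, c * v).
  have [f Af f0] := vertex_transitiveE (s0, 0) (k, 0) tr.
  have [c cJ fc] := unit_layer Af (spk f Af) j1 f0.
  by exists c => //; exists f.
apply: mul_subgroupP.
- by apply/closed_entriesP; exists s0; left.
- move=> x /closed_entriesP[k xk]; have [c ck [f Af fc]] := mapP k.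
  have cU : c \is a GRing.unit.
    apply: inj_mul_unit => v w e.
    by have [] : (s0, v) = (s0, w) by apply: (@perm_inj _ f); rewrite !fc e.
  suff [->|->] : x = c \/ x = - c by rewrite ?unitrN.
  by case: xk ck => -> [] ->; rewrite ?opprK; auto.
- move=> x y /closed_entriesP[k xk] yA; have [c ck [f Af fc]] := mapP k.
  have cy := layer_map_closed Af (spk f Af) fc yA.
  suff [->|->] : x = c \/ x = - c by rewrite ?mulNr ?closed_entriesN.
  by case: xk ck => -> [] ->; rewrite ?opprK; auto.
Qed.

(** Multiplying by c sends layer edges of step j to edges of step c j, so it has
to be combined with the permutation sg of the layers that c induces on J modulo
sign. *)
Lemma scaled_layers (c w : 'Z_n) : c \is a GRing.unit ->
  {in closed_entries J, forall x, c * x \in closed_entries J} ->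
  exists2 f : {perm GI_vertex n t}, f \in graph_aut (GI J) &
    forall s, (f (s, 0)).2 = w /\
     (c * tnth J s = tnth J (f (s, 0)).1 \/ c * tnth J s = - tnth J (f (s, 0)).1).
Proof.
move=> cU cJ.
have ex s : exists r, (c * tnth J s == tnth J r) || (c * tnth J s == - tnth J r).
  have /cJ/closed_entriesP[r cr] : tnth J s \in closed_entries J.
    by apply/closed_entriesP; exists s; left.
  by exists r; case: cr => ->; rewrite eqxx ?orbT.
pose sg s := xchoose (ex s).
have sgP s : c * tnth J s = tnth J (sg s) \/ c * tnth J s = - tnth J (sg s).
  by case/orP: (xchooseP (ex s)) => /eqP; auto.
have sg_inj : injective sg.
  move=> s r esr; apply/eqP/negP => /negP/Jinj[/eqP d1 /eqP d2].
  have [/(mulrI cU)/d1|/(mulrI cU)/d2] // :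
    c * tnth J s = c * tnth J r \/ c * tnth J s = c * - tnth J r.
  rewrite mulrN; move: (sgP s) (sgP r); rewrite -esr.
  by case=> -> [] ->; rewrite ?opprK; auto.
have f_inj : injective (fun x : GI_vertex n t => (sg x.1, c * x.2 + w)).
  move=> [s v] [s' v'] e; have /sg_inj/= -> := congr1 fst e.
  by have /addIr/(mulrI cU)/= -> := congr1 snd e.
exists (perm f_inj); last by move=> s; rewrite permE /= mulr0 add0r; split.
rewrite inE; apply/forallP=> -[s v]; apply/forallP=> -[s' v'].
rewrite !permE /GI /= (inj_eq sg_inj) (inj_eq (addIr w)) (inj_eq (mulrI cU)).
apply/eqP; congr orb; congr andb.
have shift (a : 'Z_n) : (c * v' + w == c * v + w + c * a) = (v' == v + a).
  by rewrite addrAC -mulrDr (inj_eq (addIr w)) (inj_eq (mulrI cU)).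
have := (shift (tnth J s), shift (- tnth J s)); rewrite mulrN => -[<- <-].
by case: (sgP s) => ->; rewrite ?opprK // orbC.
Qed.

Lemma subgroup_transitive s0 : tnth J s0 = 1 ->
  mul_subgroup (closed_entries J) -> vertex_transitive (GI J).
Proof.
move=> j1 [H JH]; apply: (@vertex_transitive_from _ _ (s0, 0)) => -[s w].
have inH x : x \in closed_entries J -> exists2 u, u \in H & x = FinRing.uval u.
  by rewrite JH => /imsetP[u uH ->]; exists u.
have /inH[c cH jc] : tnth J s \in closed_entries J.
  by apply/closed_entriesP; exists s; left.
have [|x /inH[u uH ->]|f Af /(_ s0)[f2]] := @scaled_layers (tnth J s) w.
- by rewrite jc (valP c).
- rewrite jc JH; apply/imsetP; exists (c * u)%g; first exact: groupM.
  by [].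
rewrite j1 mulr1 => fs; exists f => //.
rewrite [f _]surjective_pairing f2; congr pair.
apply/eqP; rewrite eq_sym; apply/negP => /negP/Jinj[/eqP d1 /eqP d2].
by case: fs.
Qed.

(** * Triangles *)

Definition in_triangle (x y : GI_vertex n t) := [exists z, GI J x z && GI J z y].

Lemma in_triangle_aut f x y : f \in graph_aut (GI J) ->
  in_triangle (f x) (f y) = in_triangle x y.
Proof.
move=> Af; apply/existsP/existsP => -[z zP].
  exists ((f^-1)%g z); move: zP; rewrite -{1 2}[z](permKV f).
  by rewrite !(graph_autE _ _ Af).
by exists (f z); rewrite !(graph_autE _ _ Af).
Qed.

Lemma spoke_in_triangle x y : (2 < t)%N -> spoke x y -> in_triangle x y.
Proof.
move=> t2 /andP[x1y1 /eqP xy2].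
have [|r] := @exists_notin 'I_t [:: x.1; y.1]; first by rewrite card_ord.
rewrite !inE negb_or => /andP[rx ry].
apply/existsP; exists (r, x.2); rewrite !spoke_GI // /spoke /=.
  by rewrite ry xy2 eqxx.
by rewrite eq_sym rx eqxx.
Qed.

(** A triangle on a layer edge cannot leave the layer, and three steps of the
same size close up only if all have the same sign. *)
Lemma layer_edge_in_triangle x y : GI J x y -> ~~ spoke x y ->
  in_triangle x y = (tnth J x.1 *+ 3 == 0).
Proof.
case: x y => s v [s' v'] xy nxy.
have /= [] := layer_edge xy nxy => e1; subst s' => ev.
set a := tnth J s in ev *; have a0 : a != 0 := tnth_neq0 s.
apply/existsP/eqP => [[[r w] /andP[]]|a3].
- have [<-|ne] := eqVneq s r; last first.
    rewrite /GI /= [r == s]eq_sym (negbTE ne) /= !orbF => /eqP <- /eqP vv.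
    case/eqP: a0; case: ev; rewrite -vv => /eqP; rewrite eq_sym -subr_eq0.
      by rewrite addrAC subrr add0r => /eqP.
    by rewrite addrAC subrr add0r oppr_eq0 => /eqP.
  rewrite !layer_edgeP -/a => ew ev'.
  have [a00|//] : a = 0 \/ a *+ 3 = 0; last by rewrite a00 eqxx in a0.
  case/orP: ew ev' => /eqP -> /orP[] /eqP; case: ev => -> e;
    have {}e := etrans (congr1 (fun z : 'Z_n => z - _) e) (subrr _);
    first [left; apply: etrans e; ring | right; apply: etrans e; ring
    | left; apply: oppr_inj; rewrite oppr0; apply: etrans e; ring
    | right; apply: oppr_inj; rewrite oppr0; apply: etrans e; ring].
- have e3 : a + a = - a by apply: (addIr a); rewrite addNr -a3 !mulrSr mulr0n add0r.
  case: ev => ->.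
    exists (s, v - a); rewrite !layer_edgeP -/a eqxx orbT /=.
    by rewrite -[v - a - a]addrA -opprD e3 opprK eqxx orbT.
  exists (s, v + a); rewrite !layer_edgeP -/a eqxx /=.
  by rewrite -[v + a + a]addrA e3 eqxx.
Qed.

(** If 3 j_s = 0, every edge at (s, 0) lies in a triangle.  By transitivity the
same holds at (r, 0) for a second layer r, so 3 j_r = 0 as well, and then j_r is
j_s or - j_s. *)
Lemma transitive_no_triangle_layer : (2 < t)%N ->
  vertex_transitive (GI J) -> forall s, tnth J s *+ 3 != 0.
Proof.
move=> t2 tr s; apply/negP => s3.
have [|r] := @exists_notin 'I_t [:: s]; first by rewrite card_ord (ltnW t2).
rewrite inE => /Jinj[jrs jrNs].
have [f Af fs] := vertex_transitiveE (s, 0) (r, 0) tr.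
have Aj : GI J (r, 0) (r, tnth J r) by rewrite layer_edgeP add0r eqxx.
have Ay : GI J (s, 0) ((f^-1)%g (r, tnth J r)).
  by rewrite -(graph_autE _ _ Af) fs permKV.
have : in_triangle (s, 0) ((f^-1)%g (r, tnth J r)).
  case: (boolP (spoke (s, 0) ((f^-1)%g (r, tnth J r)))) => [|nsp].
    exact: spoke_in_triangle.
  by rewrite layer_edge_in_triangle.
rewrite -(in_triangle_aut _ _ Af) fs permKV layer_edge_in_triangle ?spoke_irr //.
move=> r3; have [] := three_torsion (eqP s3) (eqP r3) (tnth_neq0 s) (tnth_neq0 r).
  by move=> e; rewrite e eqxx in jrs.
by move=> e; rewrite e opprK eqxx in jrNs.
Qed.

Lemma automorphism_preserves_spokes f : (2 < t)%N -> vertex_transitive (GI J) ->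
  f \in graph_aut (GI J) -> preserves_spokes f.
Proof.
move=> t2 tr Af x y.
have spokeE z u : spoke z u = GI J z u && in_triangle z u.
  apply/idP/andP => [zu|[zu]]; first by rewrite spoke_GI ?spoke_in_triangle.
  apply: contraTT => nzu; rewrite layer_edge_in_triangle //.
  exact: transitive_no_triangle_layer.
by rewrite !spokeE (graph_autE _ _ Af) in_triangle_aut.
Qed.
End GIgraph.

(** * Nonbacktracking walks *)

Section Walks.
Variables (V : finType) (e : rel V).

(** Walks without backtracking, of which the first and the last arc are prescribed
rather than the end vertices: this also controls the turn at the base point when
a walk is closed up. *)
Fixpoint nb_walks (m : nat) (a b x y : V) : nat :=
  if m is m'.+1 then \sum_(c | e b c && (c != a)) nb_walks m' b c x y
  else ((a, b) == (x, y)).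

Lemma nb_walksS m a b x y : nb_walks m.+1 a b x y =
  \sum_(c | e b c && (c != a)) nb_walks m b c x y.
Proof. by []. Qed.

Lemma nb_walks_aut (f : {perm V}) m a b x y : f \in graph_aut e ->
  nb_walks m (f a) (f b) (f x) (f y) = nb_walks m a b x y.
Proof.
move=> Af; elim: m a b => [|m IH] a b /=.
  by rewrite !xpair_eqE !(inj_eq perm_inj).
rewrite (reindex_inj (@perm_inj _ f)); apply: eq_big => c //.
by rewrite (graph_autE _ _ Af) (inj_eq perm_inj).
Qed.

(** Closed walks of length 8 through the 2-path a, b, c without backtracking,
also at the base point: the final arc (a, b) is followed by (b, c) again. *)
Definition closed_walks8 (a b c : V) := nb_walks 7 b c a b.

End Walks.

(** * Displacements of nonbacktracking words *)

Section Words.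
Local Open Scope ring_scope.

(** An arc of a two-layer graph up to translation: the layer of its origin, and
its direction, which is None along the spoke and Some d along the layer with
sign (-1) ^ d.  Layers are booleans so that words can be enumerated by
computation. *)
Definition arc_type : Type := (bool * option bool)%type.

Definition reverse (k : arc_type) : arc_type :=
  if k.2 is Some d then (k.1, Some (~~ d)) else (~~ k.1, None).

Definition nb_next (k : arc_type) : seq arc_type :=
  [seq ((reverse k).1, d) |
    d <- [:: None; Some false; Some true] & d != (reverse k).2].

(** A pair (p, q) stands for the displacement p j_0 + q j_1, kept symbolic so that
one enumeration serves all n and all steps. *)
Definition shift (k : arc_type) : int * int :=
  match k with
  | (false, Some d) => ((-1) ^+ d, 0)
  | (true, Some d) => (0, (-1) ^+ d)
  | (_, None) => (0, 0)
  end.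

Definition add_pair (z w : int * int) : int * int := (z.1 + w.1, z.2 + w.2).

Fixpoint words (m : nat) (k : arc_type) : seq (arc_type * (int * int)) :=
  if m is m'.+1 then
    [seq (w.1, add_pair (shift k) w.2) | k' <- nb_next k, w <- words m' k']
  else [:: (k, (0, 0))].

(** A displacement and its opposite vanish together; choosing one of them makes
the list of displacements the same for both directions of a layer. *)
Definition normalize_sign (z : int * int) : int * int :=
  if (z.1 < 0) || (z.1 == 0) && (z.2 < 0) then (- z.1, - z.2) else z.

(** Displacements of the closed nonbacktracking words of length 8 that begin with
k0, k1.  Such a word describes a closed walk exactly when its displacement is 0
in Z_n. *)
Definition closings (k0 k1 : arc_type) : seq (int * int) :=
  [seq normalize_sign (add_pair (shift k0) w.2) | w <- words 7 k1 & w.1 == k0].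

(** The displacements arising from 2-paths with a spoke, with two steps in layer 0
(outer) and with two steps in layer 1 (inner).  The two entries (0, 0) are the
8-cycles present in every such graph. *)
Definition mixed_closings : seq (int * int) :=
  [:: (0, 0); (0, 0); (2, 0); (2, 0); (0, 2); (0, 2); (2, 2); (2, -2);
      (5, 1); (5, -1); (4, 2); (4, -2); (3, 3); (3, -3);
      (2, 4); (2, -4); (1, 5); (1, -5)].

Definition outer_closings : seq (int * int) :=
  (8, 0) :: nseq 4 (5, 1) ++ nseq 4 (5, -1) ++ nseq 3 (4, 2) ++ nseq 3 (4, -2)
  ++ nseq 2 (3, 3) ++ nseq 2 (3, -3) ++ [:: (2, 4); (2, -4)].

Definition inner_closings : seq (int * int) :=
  (0, 8) :: nseq 4 (1, 5) ++ nseq 4 (1, -5) ++ nseq 3 (2, 4) ++ nseq 3 (2, -4)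
  ++ nseq 2 (3, 3) ++ nseq 2 (3, -3) ++ [:: (4, 2); (4, -2)].

Definition layer_closings (b : bool) :=
  if b then inner_closings else outer_closings.

Definition closings_at (b : bool) (d d' : option bool) :=
  if d && d' then layer_closings b else mixed_closings.

Lemma closingsE b d d' : d != d' ->
  perm_eq (closings (reverse (b, d)) (b, d')) (closings_at b d d').
Proof.
by case: b d d' => [] [[]|] [[]|] //= _; vm_compute.
Qed.

End Words.

(** * Counting closed walks in the two-layer graph *)

Section Petersen.
Local Open Scope ring_scope.

Variables (n : nat) (J : 2.-tuple 'Z_n).
Hypothesis J2 : forall k, tnth J k + tnth J k != 0.

Definition layer (b : bool) : 'I_2 := if b then ord_max else ord0.

Lemma layer_inj : injective layer. Proof. by case=> -[]. Qed.

Lemma layerP (s : 'I_2) : exists b, s = layer b.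
Proof.
case: s => [[|[|//]] s2]; [exists false|exists true]; exact: val_inj.
Qed.

Definition vertex (b : bool) (v : 'Z_n) : GI_vertex n 2 := (layer b, v).

Lemma vertexP x : exists b v, x = vertex b v.
Proof. by case: x => s v; have [b ->] := layerP s; exists b, v. Qed.

Definition displacement (z : int * int) : 'Z_n :=
  tnth J (layer false) *~ z.1 + tnth J (layer true) *~ z.2.

Lemma displacementD z w : displacement (add_pair z w) = displacement z + displacement w.
Proof. by rewrite /displacement /= !mulrzDr addrACA. Qed.

Lemma displacement_normalize z :
  (displacement (normalize_sign z) == 0) = (displacement z == 0).
Proof.
rewrite /normalize_sign; case: ifP => // _.
by rewrite {1}/displacement /= !mulrNz -opprD oppr_eq0.
Qed.

Definition arc_end (k : arc_type) (v : 'Z_n) : GI_vertex n 2 :=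
  vertex (if k.2 is Some _ then k.1 else ~~ k.1) (v + displacement (shift k)).

Lemma arc_end_spoke b v : arc_end (b, None) v = vertex (~~ b) v.
Proof.
by rewrite /arc_end /= /displacement; case: b; rewrite /= mulr0z addr0 addr0.
Qed.

Lemma arc_end_layer b d v :
  arc_end (b, Some d) v = vertex b (v + (-1) ^+ d * tnth J (layer b)).
Proof.
rewrite /arc_end /= /displacement; case: b d => -[] /=;
  rewrite !mulr0z ?(addr0, add0r) //.
all: by rewrite ?expr0 ?expr1 ?mulrNz ?mulr1z ?mulN1r ?mul1r.
Qed.

Lemma spoke_arc_end b d v : spoke (vertex b v) (arc_end (b, d) v) = (d == None).
Proof.
case: d => [d|]; first by rewrite arc_end_layer /vertex spoke_irr.
by rewrite arc_end_spoke /spoke /= (inj_eq layer_inj) eqxx andbT; case: b.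
Qed.

Lemma arc_end_inj b v : injective (fun d => arc_end (b, d) v).
Proof.
move=> d d' e; have := congr1 (spoke (vertex b v)) e; rewrite !spoke_arc_end.
have := J2 (layer b).
move: e; case: d d' => [d|] [d'|] //; rewrite !arc_end_layer.
move=> /(congr1 snd) /= /addrI.
case: d d' => -[]; rewrite // ?mul1r ?mulN1r => /eqP.
  by rewrite eq_sym -subr_eq0 opprK => ->.
by rewrite -subr_eq0 opprK => ->.
Qed.

Lemma GI_arc_end b v y :
  reflect (exists d, y = arc_end (b, d) v) (GI J (vertex b v) y).
Proof.
apply: (iffP idP) => [|[[d|] ->]]; last first.
- by apply: spoke_GI; rewrite spoke_arc_end.
- rewrite arc_end_layer /vertex layer_edgeP; case: d; rewrite ?mulN1r ?mul1r eqxx //.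
  by rewrite orbT.
move=> xy; case: (boolP (spoke (vertex b v) y)) => [|/(layer_edge xy)].
  case: y {xy} => s w; rewrite /spoke /= => /andP[ne /eqP <-].
  exists None; rewrite arc_end_spoke; congr pair.
  by have [c e] := layerP s; move: ne; rewrite e (inj_eq layer_inj); case: b c {e} => -[].
case: y {xy} => s w /= [-> [] ->]; [exists (Some false)|exists (Some true)].
  by rewrite arc_end_layer mul1r.
by rewrite arc_end_layer mulN1r.
Qed.

Lemma reverse_arc b d v : vertex b v = arc_end (reverse (b, d)) (arc_end (b, d) v).2.
Proof.
case: d => [d|]; last first.
  by rewrite [arc_end (b, _) v]arc_end_spoke [reverse _]/= arc_end_spoke negbK.
rewrite [arc_end (b, _) v]arc_end_layer [reverse _]/= arc_end_layer /=; congr pair.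
by case: d => /=; rewrite ?(mulN1r, mul1r) ?addrK ?subrK.
Qed.

Lemma arc_end_vertex b d v :
  arc_end (b, d) v = vertex (reverse (b, d)).1 (arc_end (b, d) v).2.
Proof. by case: d. Qed.

Lemma big_nb_next b d v (F : GI_vertex n 2 -> nat) :
  (\sum_(c | GI J (arc_end (b, d) v) c && (c != vertex b v)) F c =
   \sum_(k <- nb_next (b, d)) F (arc_end k (arc_end (b, d) v).2))%N.
Proof.
rewrite [vertex b v](reverse_arc b d) {1}arc_end_vertex /nb_next.
case: (reverse (b, d)) => b' d'; rewrite ![(b', d').1]/= ![(b', d').2]/=.
move: (arc_end (b, d) v).2 => w.
rewrite big_map; set s := [seq _ <- _ | _].
rewrite -(big_map (fun d => arc_end (b', d) w) predT F) big_uniq; last first.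
  by rewrite (map_inj_uniq (@arc_end_inj b' w)) filter_uniq.
apply: eq_bigl => c; apply/andP/mapP => [[/GI_arc_end[e ->] ne]|[e es ->]].
  exists e => //; rewrite mem_filter; apply/andP; split.
    by apply: contraNneq ne => ->.
  by case: e {ne} => // -[].
split; first by apply/GI_arc_end; exists e.
rewrite (inj_eq (@arc_end_inj b' w)).
by move: es; rewrite mem_filter => /andP[].
Qed.

(** The walks of the graph correspond to words, each placed at its origin. *)
Lemma nb_walks_words m k v x y :
  nb_walks (GI J) m (vertex k.1 v) (arc_end k v) x y =
  (\sum_(w <- words m k)
     ((vertex w.1.1 (v + displacement w.2)%R,
       arc_end w.1 (v + displacement w.2)%R) == (x, y)))%N.
Proof.
elim: m k v => [|m IH] [b d] v.
  by rewrite big_seq1 /= /displacement /= !mulr0z !addr0.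
rewrite nb_walksS big_nb_next [RHS]big_allpairs_dep.
apply: eq_big_seq => k /mapP[d' _ ->{k}].
rewrite [arc_end (b, d) v]arc_end_vertex (IH (_, d')).
apply: eq_bigr => w _.
have -> : (arc_end (b, d) v).2 = v + displacement (shift (b, d)) by [].
by rewrite -addrA -displacementD.
Qed.

Lemma arc_eq k v k' v' :
  ((vertex k.1 v, arc_end k v) == (vertex k'.1 v', arc_end k' v')) =
  (k == k') && (v == v').
Proof.
apply/eqP/andP => [|[/eqP -> /eqP ->] //].
case: k k' => b d [b' d'] e.
have [/= /layer_inj eb ev0] : layer b = layer b' /\ v = v'.
  by split; [have := congr1 (fun x => x.1.1) e|have := congr1 (fun x => x.1.2) e].
subst b' v'; have /arc_end_inj -> := congr1 snd e.
by rewrite !eqxx.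
Qed.

Lemma closed_walks8E b d d' v :
  closed_walks8 (GI J) (arc_end (b, d) v) (vertex b v) (arc_end (b, d') v) =
  (\sum_(z <- closings (reverse (b, d)) (b, d')) (displacement z == 0%R))%N.
Proof.
rewrite /closed_walks8 (nb_walks_words 7 (b, d')) /closings.
rewrite big_map big_filter [RHS]big_mkcond.
apply: eq_bigr => w _; rewrite displacement_normalize displacementD.
have := reverse_arc b d v; rewrite [arc_end (b, d) v]arc_end_vertex.
move: (reverse (b, d)) (arc_end (b, d) v).2 => k0 w0 vk0.
rewrite vk0 arc_eq; case: eqP => //= _.
have -> : v = w0 + displacement (shift k0) by have := congr1 snd vk0.
by rewrite -addrA -subr_eq0 addrAC subrr add0r.
Qed.

Definition closed_count (s : seq (int * int)) : nat :=
  (\sum_(z <- s) (displacement z == 0%R))%N.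

Lemma closed_walks8_at b d d' v : d != d' ->
  closed_walks8 (GI J) (arc_end (b, d) v) (vertex b v) (arc_end (b, d') v) =
  closed_count (closings_at b d d').
Proof. by move=> dd'; rewrite closed_walks8E (perm_big _ (closingsE b dd')). Qed.

Lemma aut_arc_ends (f : {perm GI_vertex n 2}) b v b' v' :
  f \in graph_aut (GI J) -> f (vertex b v) = vertex b' v' ->
  exists2 g : option bool -> option bool, injective g &
    forall d, f (arc_end (b, d) v) = arc_end (b', g d) v'.
Proof.
move=> Af fv.
have ex d : exists d', f (arc_end (b, d) v) == arc_end (b', d') v'.
  have /GI_arc_end[d' ->] : GI J (vertex b' v') (f (arc_end (b, d) v)).
    by rewrite -fv (graph_autE _ _ Af); apply/GI_arc_end; exists d.
  by exists d'.
exists (fun d => xchoose (ex d)) => [d d' e|d]; last exact/eqP/(xchooseP (ex d)).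
have := eqP (xchooseP (ex d)); rewrite e -(eqP (xchooseP (ex d'))).
by move=> /perm_inj/arc_end_inj.
Qed.

(** An automorphism acts on the three directions at a vertex by a bijection g.  If
g fixes the spoke, it takes the pair of layer directions to such a pair.
Otherwise it exchanges that pair with a pair containing the spoke, at the source
and at the target. *)
Lemma aut_counts (f : {perm GI_vertex n 2}) b v b' v' :
  f \in graph_aut (GI J) -> f (vertex b v) = vertex b' v' ->
  if f (arc_end (b, None) v) == arc_end (b', None) v'
  then closed_count (layer_closings b) = closed_count (layer_closings b')
  else closed_count (layer_closings b) = closed_count mixed_closings /\
       closed_count (layer_closings b') = closed_count mixed_closings.
Proof.
move=> Af fv; have [g gI fg] := aut_arc_ends Af fv.
have cnt d d' : d != d' ->
    closed_count (closings_at b d d') = closed_count (closings_at b' (g d) (g d')).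
  move=> dd'; rewrite -(closed_walks8_at b v dd').
  have gdd' : g d != g d' by rewrite (inj_eq gI).
  rewrite -(closed_walks8_at b' v' gdd') -!fg -fv.
  by rewrite /closed_walks8 nb_walks_aut.
rewrite fg (inj_eq (@arc_end_inj b' v')).
have := cnt None (Some true) isT; have := cnt None (Some false) isT.
have := cnt (Some true) (Some false) isT.
have := inj_eq gI None (Some true); have := inj_eq gI None (Some false).
have := inj_eq gI (Some true) (Some false).
rewrite /closings_at.
by case: (g None) (g (Some true)) (g (Some false))
  => [[]|] [[]|] [[]|] //= _ _ _ -> -> ->.
Qed.

Lemma preserves_spokesP (f : {perm GI_vertex n 2}) : f \in graph_aut (GI J) ->
  (forall b v b' v', f (vertex b v) = vertex b' v' ->
     f (arc_end (b, None) v) = arc_end (b', None) v') -> preserves_spokes f.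
Proof.
move=> Af fN x y; have [b [v ->]] := vertexP x.
have [b' [v' fv]] := vertexP (f (vertex b v)).
have fN1 := fN _ _ _ _ fv.
have spokeE c w z : spoke (vertex c w) z = (z == arc_end (c, None) w).
  apply/idP/eqP => [sz|->]; last by rewrite spoke_arc_end.
  have /GI_arc_end[d ez] := spoke_GI J sz.
  by move: sz; rewrite ez spoke_arc_end => /eqP ->.
by rewrite fv !spokeE -fN1 (inj_eq perm_inj).
Qed.

(** One automorphism moving a spoke equates the counts for its layer with the mixed
one; transitivity carries the equality to the other layer. *)
Lemma spokes_or_counts : vertex_transitive (GI J) ->
  (forall f : {perm GI_vertex n 2}, f \in graph_aut (GI J) -> preserves_spokes f) \/
  forall b, closed_count (layer_closings b) = closed_count mixed_closings.
Proof.
move=> tr.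
case: (boolP [forall f in graph_aut (GI J), forall b, forall v, forall b', forall v',
  (f (vertex b v) == vertex b' v') ==>
  (f (arc_end (b, None) v) == arc_end (b', None) v')]) => [/forall_inP all|].
  left=> f Af; apply: preserves_spokesP => // b v b' v' /eqP fv.
  apply/eqP; move: fv; apply/implyP.
  by move: (all f Af) => /forallP/(_ b)/forallP/(_ v)/forallP/(_ b')/forallP/(_ v').
rewrite negb_forall_in => /exists_inP[f Af]; rewrite negb_forall => /existsP[b].
rewrite negb_forall => /existsP[v]; rewrite negb_forall => /existsP[b'].
rewrite negb_forall => /existsP[v']; rewrite negb_imply => /andP[/eqP fv fN].
right; have := aut_counts Af fv; rewrite (negbTE fN) => -[lb _] c.
have [h Ah hc] := vertex_transitiveE (vertex c 0) (vertex b 0) tr.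
by have := aut_counts Ah hc; case: ifP => _ => [->|[]].
Qed.
End Petersen.

(** * Solving the counting equations *)

Section Arithmetic.
Local Open Scope ring_scope.

Lemma intr_Zp_eq0 (n : nat) (m : int) : (1 < n)%N ->
  (m%:~R == 0 :> 'Z_n) = (n %| m)%Z.
Proof.
move=> n1; rewrite dvdzE absz_nat.
by case: m => m; rewrite ?NegzE ?mulrNz ?oppr_eq0 ?abszN;
  rewrite -val_eqE /= val_Zp_nat.
Qed.

(** The same count with the congruences as divisibilities of integers, in a form
that computes. *)
Definition dvd_count (n k : nat) (s : seq (int * int)) : nat :=
  sumn [seq nat_of_bool (n %| z.1 + z.2 * k%:Z)%Z | z <- s].

Lemma closed_countE (n : nat) (J : 2.-tuple 'Z_n) s : (1 < n)%N ->
  tnth J (layer false) = 1 ->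
  closed_count J s = dvd_count n (tnth J (layer true)) s.
Proof.
move=> n1 j0; rewrite /dvd_count sumnE big_map.
apply: eq_bigr => z _; rewrite /displacement j0.
rewrite -intr_Zp_eq0 // rmorphD rmorphM /=.
by rewrite mulrzl -pmulrn natr_Zp.
Qed.

Lemma dvdz_small (n : nat) (m : int) : - (4 * n%:Z) < m < 4 * n%:Z ->
  (n %| m)%Z -> [\/ m = 0, m = n \/ m = - n%:Z, m = 2 * n%:Z \/ m = - (2 * n%:Z) |
                 m = 3 * n%:Z \/ m = - (3 * n%:Z)].
Proof.
move=> mn /dvdzP[q qm]; have q4 : -4 < q < 4 by nia.
move: qm; have : q \in [:: -3; -2; -1; 0; 1; 2; 3] by rewrite !inE; lia.
rewrite !inE => /or4P[||| /or4P[]] /eqP -> e.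
- by apply: Or44; right; lia.
- by apply: Or43; right; lia.
- by apply: Or42; right; lia.
- by apply: Or41; lia.
- by apply: Or42; left; lia.
- by apply: Or43; left; lia.
- by apply: Or44; left; lia.
Qed.

(* The coefficients are at most 8 and k < n / 2, so each p + q k has absolute
   value below 4 n. *)
Ltac small_dvdz n26 k1 kn := clear -n26 k1 kn; case/dvdz_small; lia.

Ltac off b E n26 k1 kn h :=
  have {E} -> : b = false by apply/negP => /E; clear -n26 k1 kn h; lia.

(** Let [z] be 1 if z is divisible by n and 0 otherwise.  Cancelling common terms
and impossible congruences, the two equations become
  3 [5 - k] + 2 ([4 + 2k] + [4 - 2k]) + [3 + 3k] + [3 - 3k]
    = 2 + [2 + 2k] + [1 + 5k] + [1 - 5k],
  [8k] + [3 + 3k] + [3 - 3k] + 2 ([2 + 4k] + [2 - 4k]) + 3 ([1 + 5k] + [1 - 5k])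
    = 2 + [2 + 2k] + [5 - k].
For n > 26 any two of these congruences are incompatible, except that [5 - k]
and [8k] may both be 1, so the first equation fails unless [4 + 2k] or [4 - 2k]
is 1, and then the second one fails. *)
Lemma dvd_count_large (n k : nat) : (26 < n)%N -> (1 < k)%N -> (2 * k < n)%N ->
  dvd_count n k outer_closings = dvd_count n k mixed_closings ->
  dvd_count n k inner_closings = dvd_count n k mixed_closings -> False.
Proof.
move=> n26 k1 kn.
have E51 : (n %| 5 + 1 * k%:Z)%Z = false by apply/negP; small_dvdz n26 k1 kn.
have E22' : (n %| 2 + -2 * k%:Z)%Z = false by apply/negP; small_dvdz n26 k1 kn.
have E80 : (n %| 8 + 0 * k%:Z)%Z = false by apply/negP; small_dvdz n26 k1 kn.
have E20 : (n %| 2 + 0 * k%:Z)%Z = false by apply/negP; small_dvdz n26 k1 kn.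
have E02 : (n %| 0 + 2 * k%:Z)%Z = false by apply/negP; small_dvdz n26 k1 kn.
have E00 : (n %| 0 + 0 * k%:Z)%Z = true by rewrite mul0r addr0 dvdz0.
have E51' : (n %| 5 + -1 * k%:Z)%Z -> k = 5%N by small_dvdz n26 k1 kn.
have E42 : (n %| 4 + 2 * k%:Z)%Z -> (2 * k + 4 = n)%N by small_dvdz n26 k1 kn.
have E42' : (n %| 4 + -2 * k%:Z)%Z -> k = 2%N by small_dvdz n26 k1 kn.
have E33 : (n %| 3 + 3 * k%:Z)%Z -> (3 * k + 3 = n)%N by small_dvdz n26 k1 kn.
have E33' : (n %| 3 + -3 * k%:Z)%Z -> (3 * k = n + 3)%N by small_dvdz n26 k1 kn.
have E24 : (n %| 2 + 4 * k%:Z)%Z -> (4 * k + 2 = n \/ 2 * k + 1 = n)%N.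
  by small_dvdz n26 k1 kn.
have E24' : (n %| 2 + -4 * k%:Z)%Z -> (4 * k = n + 2)%N by small_dvdz n26 k1 kn.
have E15 : (n %| 1 + 5 * k%:Z)%Z -> (5 * k + 1 = n \/ 5 * k + 1 = 2 * n)%N.
  by small_dvdz n26 k1 kn.
have E15' : (n %| 1 + -5 * k%:Z)%Z -> (5 * k = n + 1 \/ 5 * k = 2 * n + 1)%N.
  by small_dvdz n26 k1 kn.
have E22 : (n %| 2 + 2 * k%:Z)%Z -> (2 * k + 2 = n)%N by small_dvdz n26 k1 kn.
have E08 : (n %| 0 + 8 * k%:Z)%Z -> (8 * k = n \/ 8 * k = 2 * n \/ 8 * k = 3 * n)%N.
  by small_dvdz n26 k1 kn.
rewrite /dvd_count /=.
rewrite E51 E22' E80 E20 E02 E00.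
clear E51 E22' E80 E20 E02 E00.
move: (n %| 5 + -1 * k%:Z)%Z E51' => b51 E51'.
move: (n %| 4 + 2 * k%:Z)%Z E42 => b42 E42.
move: (n %| 4 + -2 * k%:Z)%Z E42' => b42' E42'.
move: (n %| 3 + 3 * k%:Z)%Z E33 => b33 E33.
move: (n %| 3 + -3 * k%:Z)%Z E33' => b33' E33'.
move: (n %| 2 + 4 * k%:Z)%Z E24 => b24 E24.
move: (n %| 2 + -4 * k%:Z)%Z E24' => b24' E24'.
move: (n %| 1 + 5 * k%:Z)%Z E15 => b15 E15.
move: (n %| 1 + -5 * k%:Z)%Z E15' => b15' E15'.
move: (n %| 2 + 2 * k%:Z)%Z E22 => b22 E22.
move: (n %| 0 + 8 * k%:Z)%Z E08 => b08 E08.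
case: b51 E51' => [/(_ isT) h|_].
  off b42 E42 n26 k1 kn h.
  off b42' E42' n26 k1 kn h.
  off b33 E33 n26 k1 kn h.
  off b33' E33' n26 k1 kn h.
  off b24 E24 n26 k1 kn h.
  off b24' E24' n26 k1 kn h.
  off b15 E15 n26 k1 kn h.
  off b15' E15' n26 k1 kn h.
  off b22 E22 n26 k1 kn h.
  by [].
case: b42 E42 => [/(_ isT) h|_].
  off b42' E42' n26 k1 kn h.
  off b33 E33 n26 k1 kn h.
  off b33' E33' n26 k1 kn h.
  off b24 E24 n26 k1 kn h.
  off b24' E24' n26 k1 kn h.
  off b15 E15 n26 k1 kn h.
  off b15' E15' n26 k1 kn h.
  off b22 E22 n26 k1 kn h.
  off b08 E08 n26 k1 kn h.
  by [].
case: b42' E42' => [/(_ isT) h|_].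
  off b33 E33 n26 k1 kn h.
  off b33' E33' n26 k1 kn h.
  off b24 E24 n26 k1 kn h.
  off b24' E24' n26 k1 kn h.
  off b15 E15 n26 k1 kn h.
  off b15' E15' n26 k1 kn h.
  off b22 E22 n26 k1 kn h.
  off b08 E08 n26 k1 kn h.
  by [].
case: b33 E33 => [/(_ isT) h|_].
  off b33' E33' n26 k1 kn h.
  by clear; case: b24 b24' b15 b15' b22 => -[] [] [] [].
by clear; case: b33' b24 b24' b15 b15' b22 => -[] [] [] [] [].
Qed.

(** The bound 26 is sharp: (n, k) = (26, 5) satisfies both equations, with
k^2 = -1. *)
Lemma dvd_count_square (n k : nat) : (1 < k)%N -> (2 * k < n)%N ->
  dvd_count n k outer_closings = dvd_count n k mixed_closings ->
  dvd_count n k inner_closings = dvd_count n k mixed_closings ->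
  [\/ k * k %% n = 1, k * k %% n = n.-1 | n = 10 /\ k = 2]%N.
Proof.
move=> k1 kn eO eI; case: (leqP n 26) => n26; last first.
  by case: (dvd_count_large n26 k1 kn eO eI).
pose test n k := [&& (1 < k)%N, (2 * k < n)%N,
  dvd_count n k outer_closings == dvd_count n k mixed_closings &
  dvd_count n k inner_closings == dvd_count n k mixed_closings] ==>
  [|| k * k %% n == 1, k * k %% n == n.-1 | (n == 10) && (k == 2)]%N.
have : all (fun n => all (test n) (iota 0 13)) (iota 0 27) by vm_compute.
move=> /allP/(_ n); rewrite mem_iota => /(_ n26) /allP/(_ k).
rewrite mem_iota /= => /(_ ltac:(lia)); rewrite /test k1 kn eO eI !eqxx /=.
case/or3P => [/eqP|/eqP|/andP[/eqP -> /eqP ->]].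
- exact: Or31.
- exact: Or32.
- exact: Or33.
Qed.
End Arithmetic.

(** * The dodecahedron GI(10; 1, 2) *)

Section Dodecahedron.
Local Open Scope ring_scope.

(** Images of (0, 0), ..., (0, 9), (1, 0), ..., (1, 9) under an involution that
exchanges the ends (0, 0) and (1, 0) of a spoke. *)
Definition dodecahedron_swap_table : seq (bool * nat) :=
  [:: (true, 0); (true, 2); (false, 2); (false, 3); (true, 3);
      (true, 5); (true, 7); (false, 7); (false, 8); (true, 8);
      (false, 0); (true, 4); (false, 1); (false, 4); (true, 1);
      (false, 5); (true, 9); (false, 6); (false, 9); (true, 6)]%N.

Definition dodecahedron_swap (x : GI_vertex 10 2) : GI_vertex 10 2 :=
  let c := nth (false, 0%N) dodecahedron_swap_table (10 * x.1 + x.2)%N in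
  (layer c.1, inZp c.2).

Definition dodecahedron_vertices : seq (GI_vertex 10 2) :=
  [seq (layer b, inZp v) | b <- [:: false; true], v <- iota 0 10].

Lemma dodecahedron_verticesP x : x \in dodecahedron_vertices.
Proof.
case: x => s v; have [b ->] := layerP s.
apply/allpairsP; exists (b, v : nat); split; first by case: b.
  by rewrite mem_iota ltn_ord.
by congr pair; rewrite /= valZpK.
Qed.

Lemma dodecahedron_swapK : involutive dodecahedron_swap.
Proof.
have /allP ok : all (fun x => dodecahedron_swap (dodecahedron_swap x) == x)
  dodecahedron_vertices by vm_compute.
by move=> x; apply/eqP/ok/dodecahedron_verticesP.
Qed.

Lemma dodecahedron_swap_aut :
  perm (inv_inj dodecahedron_swapK) \in graph_aut (GI [tuple 1; 2 : 'Z_10]).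
Proof.
have ok : all (fun x => all (fun y => GI [tuple 1; 2 : 'Z_10]
   (dodecahedron_swap x) (dodecahedron_swap y) == GI [tuple 1; 2 : 'Z_10] x y)
  dodecahedron_vertices) dodecahedron_vertices by vm_compute.
rewrite inE; apply/forallP=> x; apply/forallP=> y; rewrite !permE.
have /allP/(_ y (dodecahedron_verticesP y)) :=
  allP ok x (dodecahedron_verticesP x).
by [].
Qed.

Lemma dodecahedron_transitive : vertex_transitive (GI [tuple 1; 2 : 'Z_10]).
Proof.
set J := [tuple 1; 2].
have Jinj i k : i != k -> tnth J i != tnth J k /\ tnth J i != - tnth J k.
  have [b ->] := layerP i; have [c ->] := layerP k.
  by rewrite (inj_eq layer_inj); case: b c => -[].
have tau w : exists2 f : {perm GI_vertex 10 2}, f \in graph_aut (GI J) &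
    forall b, f (layer b, 0) = (layer b, w).
  have [||f Af fP] := @scaled_layers _ _ J Jinj 1 w; first exact: unitr1.
    by move=> x; rewrite mul1r.
  exists f => // b; have [f2 f1] := fP (layer b).
  rewrite [f _]surjective_pairing f2; congr pair; apply/eqP.
  rewrite eq_sym; apply/negP => /negP/Jinj [/eqP d1 /eqP d2].
  by move: f1; rewrite mul1r; case.
apply: (@vertex_transitive_from _ _ (layer false, 0)) => -[s w].
have [[] ->] := layerP s; have [f Af fw] := tau w; last by exists f.
exists (perm (inv_inj dodecahedron_swapK) * f)%g.
  by rewrite groupM ?dodecahedron_swap_aut.
by rewrite permM permE -fw; congr (f _); apply/eqP; vm_compute.
Qed.

End Dodecahedron.

(** * The characterization *)

Section Main.
Local Open Scope ring_scope.

Lemma petersen_subgroup (n : nat) (J : 2.-tuple 'Z_n) :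
  tnth J (layer false) = 1 ->
  tnth J (layer true) ^+ 2 = 1 \/ tnth J (layer true) ^+ 2 = - 1 ->
  mul_subgroup (closed_entries J).
Proof.
set k := tnth J (layer true) => j0; rewrite expr2 => kk.
have jP b : tnth J (layer b) = if b then k else 1.
  by case: b.
have jA b : (if b then k else 1) \in closed_entries J.
  by apply/closed_entriesP; exists (layer b); left.
have AP x : x \in closed_entries J ->
    exists b, x = (if b then k else 1) \/ x = - (if b then k else 1).
  by move=> /closed_entriesP[s]; have [b ->] := layerP s; rewrite jP; exists b.
apply: mul_subgroupP => [|x /AP[b xb]|x y /AP[b xb] /AP[c yc]].
- exact: (jA false).
- have kU : k \is a GRing.unit.
    by apply/unitrPr; case: kk => kk; [exists k|exists (- k); rewrite mulrN kk opprK].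
  by case: xb => ->; rewrite ?unitrN; case: b; rewrite ?unitr1.
suff bc : (if b then k else 1) * (if c then k else 1) \in closed_entries J.
  by case: xb yc => -> [] ->; rewrite ?mulrN ?mulNr ?opprK ?closed_entriesN.
case: b c {xb yc} => -[]; rewrite ?mul1r ?mulr1; try exact: (jA true).
  by case: kk => ->; rewrite ?closed_entriesN; apply: (jA false).
exact: (jA false).
Qed.

Lemma standard_double_neq0 (n t : nat) (J : t.-tuple 'Z_n) k : (1 < n)%N ->
  standard_form J -> tnth J k + tnth J k != 0.
Proof.
move=> n1 [/(_ k) [j0 jn] _]; have nE := Zp_cast n1.
by rewrite -val_eqE /= modn_small; lia.
Qed.

(** The steps are sorted and 1 is the least positive residue. *)
Lemma petersen_first (n : nat) (J : 2.-tuple 'Z_n) : (1 < n)%N ->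
  1 \in J -> standard_form J -> tnth J (layer false) = 1.
Proof.
move=> n1 /tnthP[s0 e] [jn jle]; have := jle (layer false) s0 isT.
have [] := jn (layer false); rewrite -e => j0 _ le.
have v1 : nat_of_ord (1 : 'Z_n) = 1%N by [].
by apply: ord_inj; rewrite v1; rewrite v1 in le; lia.
Qed.

Lemma petersen_case (n : nat) (J : 2.-tuple 'Z_n) : (2 < n)%N ->
  primitive J -> standard_form J -> vertex_transitive (GI J) ->
  mul_subgroup (closed_entries J) \/
  (n = 10%N /\ entries J = [set 1; 2%:R]).
Proof.
move=> n2 [J1 Jinj] Jst tr; have n1 : (1 < n)%N by lia.
have J2 k := standard_double_neq0 k n1 Jst.
have j0 := petersen_first n1 J1 Jst.
have [spk|cnt] := spokes_or_counts J2 tr.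
  by left; apply: transitive_spokes_subgroup j0 tr spk.
have := cnt true; have := cnt false; rewrite !(closed_countE _ n1 j0) => eO eI.
case: (Jst) => /(_ (layer true)) [k0 kn] _.
have k1 : (1 < tnth J (layer true))%N.
  rewrite ltn_neqAle k0 andbT; apply/eqP => k1.
  have [/eqP[]] := Jinj (layer false) (layer true) isT.
  by rewrite j0; apply: val_inj; rewrite /= -k1.
set k := tnth J (layer true) in k0 kn k1 eO eI.
have kkE : k * k = ((k * k)%N %% n)%N%:R by rewrite Zp_nat_mod // natrM !natr_Zp.
have [kk|kk|[n10 k2]] := dvd_count_square k1 kn eO eI.
- by left; apply: petersen_subgroup => //; left; rewrite expr2 -/k kkE kk.
- left; apply: petersen_subgroup => //; right; rewrite expr2 -/k kkE kk.
  apply/eqP; rewrite -addr_eq0 natr1 prednK; last by lia.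
  by rewrite -(Zp_nat_mod n1) modnn.
right; split=> //; apply/setP=> x; rewrite !inE.
have e2 : k = 2%:R by rewrite -[k]natr_Zp k2.
apply/tnthP/orP => [[s ->]|].
  by have [[] ->] := layerP s; rewrite ?j0 -/k ?e2 eqxx; [right|left].
by case=> /eqP ->; [exists (layer false)|exists (layer true); rewrite -/k].
Qed.

Lemma tuple_entries2 (n t : nat) (J : t.-tuple 'Z_n) :
  primitive J -> entries J = [set 1; 2%:R] -> t = 2%N.
Proof.
move=> [_ Jinj] eJ.
have uJ : uniq J.
  apply/tuple_uniqP => i k e; apply/eqP/negP => /negP/Jinj[].
  by rewrite e eqxx.
have := congr1 (fun A : {set 'Z_n} => #|A|) eJ.
rewrite cardsE (card_uniqP uJ) size_tuple cards2 => ->.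
by rewrite mulr2n eq_sym -subr_eq0 addrK oner_eq0.
Qed.

Lemma dodecahedron_case (J : 2.-tuple 'Z_10) :
  primitive J -> standard_form J -> entries J = [set 1; 2%:R] ->
  vertex_transitive (GI J).
Proof.
move=> [J1 Jinj] Jst eJ.
have j0 := petersen_first (isT : 1 < 10)%N J1 Jst.
have j1 : tnth J (layer true) = 2%:R.
  have : tnth J (layer true) \in entries J by rewrite inE mem_tnth.
  rewrite eJ !inE -j0 => /orP[|/eqP //].
  by have [/negbTE ->] := Jinj (layer true) (layer false) isT.
have -> : J = [tuple 1; 2].
  apply: eq_from_tnth => s; have [[] ->] := layerP s; first by rewrite j1.
  by rewrite j0.
exact: dodecahedron_transitive.
Qed.

End Main.

Theorem theorem18 (n t : nat) (J : t.-tuple 'Z_n) :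
  (3 <= n)%N -> (1 <= t)%N -> primitive J -> standard_form J ->
  (vertex_transitive (GI J) <->
  mul_subgroup (entries J :|: [set (- j)%R | j in entries J]) \/
  (n = 10 /\ entries J = [set 1%R; 2%R])).
Proof.
move=> n2 t0 Jpr Jst; have n1 : 1 < n by apply: ltnW.
have J2 k := standard_double_neq0 k n1 Jst.
have [J1 Jinj] := Jpr; have /tnthP[s0 /esym j1] := J1.
split=> [tr|[Jsub|[n10 eJ]]].
- case: (ltngtP t 2) => [t2|t2|t2].
  + left; apply: (transitive_spokes_subgroup J2 j1 tr) => // f Af x y.
    have same (i k : 'I_t) : i = k.
      by apply: ord_inj; move: (ltn_ord i) (ltn_ord k); lia.
    by rewrite /spoke (same (f x).1 (f y).1) (same x.1 y.1) !eqxx.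
  + left; apply: (transitive_spokes_subgroup J2 j1 tr) => // f Af.
    exact: (automorphism_preserves_spokes J2 Jinj t2 tr Af).
  + by subst t; apply: petersen_case.
- exact: subgroup_transitive j1 Jsub.
have t2 := tuple_entries2 Jpr eJ.
by subst t n; apply: dodecahedron_case.
Qed.
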